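(* Let $t>0$ and $s>1$ with $s-2t<1$, and let $$g_{s,t}(r)=\sum_{n=1}^\infty n^{-s+2t}\sin^2(n^{-t}r),\qquad r\ge0.$$ Then $$g_{s,t}(r)=C_{s,t}\,r^{\frac{-s+2t+1}{t}}(1+o(1)),\qquad r\to\infty,$$ where $C_{s,t}=\frac1t\int_0^\infty u^{\frac{s-3t-1}{t}}\sin^2(u)\,du$. *)

(* Defs.v *)
From HB Require Import structures.
From mathcomp Require Import all_boot all_order all_algebra.
From mathcomp Require Import all_classical all_reals all_analysis.

Set Implicit Arguments.
Unset Strict Implicit.
Unset Printing Implicit Defensive.

Import Order.TTheory GRing.Theory Num.Theory.
Import numFieldNormedType.Exports.

Local Open Scope classical_set_scope.
Local Open Scope ring_scope.

Section defs.
Context {R : realType}.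
Implicit Types s t r u : R.

Definition g_term s t r (n : nat) : R :=
  n%:R `^ (- s + 2 * t) * sin (n%:R `^ (- t) * r) ^+ 2.

(* [limn] is total: this is meaningful only when the series converges. *)
Definition g s t r : R :=
  limn (fun N : nat => \sum_(1 <= n < N) g_term s t r n).

Definition C_integrand s t u : R :=
  u `^ ((s - 3 * t - 1) / t) * sin u ^+ 2.

(* [\int] is total: this is meaningful only when the integrand is
   integrable. *)
Definition C_ s t : R :=
  t^-1 * \int[lebesgue_measure]_(u in `]0, +oo[) C_integrand s t u.

End defs.

(* Main.v *)
(** With h = r^(-1/t) and phi(x) = x^(-s+2t) sin^2(x^(-t)), the n-th term of the
    series is r^((-s+2t+1)/t) * h phi(n h).  Hence g_{s,t}(r) is
    r^((-s+2t+1)/t) times a Riemann sum of mesh h, which is the integral over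
    ]0, +oo[ of the step function x |-> phi(h * ceil(x / h)).  Since
    phi(x) <= min(x^(-s+2t), x^(-s)), these step functions are dominated by an
    integrable function uniformly in h <= 1, so the integrals converge to that
    of phi as h -> 0+; the substitution u = x^(-t) identifies the limit with
    C_{s,t}, which is positive. *)

Require Import Defs.
From HB Require Import structures.
From mathcomp Require Import all_boot all_order all_algebra.
From mathcomp Require Import all_classical all_reals all_analysis.
From mathcomp Require Import measurable_realfun ring lra.

Set Implicit Arguments.
Unset Strict Implicit.
Unset Printing Implicit Defensive.

Import Order.TTheory GRing.Theory Num.Theory.
Import numFieldNormedType.Exports.

Local Open Scope classical_set_scope.
Local Open Scope ring_scope.

(** * Powers and integrals on the positive half-line *)

Section positive_half_line.
Context {R : realType}.
Implicit Types (f : R -> R) (x y p t : R).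
Local Notation mu := (@lebesgue_measure R).

Lemma continuous_powR p x : 0 < x -> {for x, continuous (@powR R ^~ p)}.
Proof.
move=> x0; apply/differentiable_continuous/derivable1_diffP.
by apply: derivable_powR; rewrite in_itv/= x0.
Qed.

Lemma powR_Nltr p x y : p < 0 -> 0 < x -> x < y -> y `^ p < x `^ p.
Proof.
move=> p0 x0 xy; rewrite -[p]opprK !(powRN _ (- p)) ltf_pV2 ?posrE ?powR_gt0//.
  by rewrite gt0_ltr_powR// ?oppr_gt0// nnegrE ltW// (lt_trans x0).
exact: lt_trans xy.
Qed.

Lemma powR_Nler p x y : p <= 0 -> 0 < x -> x <= y -> y `^ p <= x `^ p.
Proof.
rewrite le_eqVlt => /predU1P[->|p0]; first by rewrite !powRr0.
move=> x0; rewrite le_eqVlt => /predU1P[->//|xy].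
by rewrite ltW// powR_Nltr.
Qed.

(** Oddness reduces to [0 < x]; then the mean value theorem applies, the derivative [cos] being
    bounded by 1. *)
Lemma norm_sin_le x : `|sin x| <= `|x|.
Proof.
wlog x0 : x / 0 < x.
  have [->|/lt_total/orP[] x0 H] := eqVneq x 0; first by rewrite sin0.
    by rewrite -normrN -sinN -(normrN x) H// oppr_gt0.
  exact: H.
have [y _] := @MVT_segment R (@sin R) (@cos R) 0 x (ltW x0)
  (fun y _ => is_derive_sin y)
  (continuous_subspaceT (@continuous_sin R)).
rewrite sin0 !subr0 => ->.
by rewrite normrM ler_piMl// cos_max.
Qed.

Lemma continuous_measurable_pos f :
  (forall x, 0 < x -> {for x, continuous f}) -> measurable_fun `](0:R), +oo[ f.
Proof.
move=> cf; apply: open_continuous_measurable_fun => //.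
by move=> x; rewrite inE/= in_itv/= andbT => /cf.
Qed.

Lemma continuous_within_pos f (A : set R) :
  (forall x, 0 < x -> {for x, continuous f}) -> A `<=` `]0, +oo[ ->
  {within A, continuous f}.
Proof.
move=> cf A0; apply: continuous_in_subspaceT => x.
by rewrite inE => /A0/=; rewrite in_itv/= andbT => /cf.
Qed.

(** * Exhaustion by segments and improper integrals of powers *)

(** The hypotheses force [D] to be the increasing union of the segments, so this is monotone
    convergence. It carries results known only on segments over to unbounded or half-open
    domains. *)
Lemma cvg_integral_cover (D : set R) (f : R -> \bar R) (a b : R^nat) :
  nonincreasing_seq a -> nondecreasing_seq b ->
  (forall n, `[a n, b n] `<=` D) ->
  (forall x, D x -> exists n, a n <= x <= b n) ->
  measurable D -> measurable_fun D f -> (forall x, D x -> 0 <= f x)%E ->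
  (\int[mu]_(x in `[a n, b n]) f x)%E @[n --> \oo] -->
  (\int[mu]_(x in D) f x)%E.
Proof.
move=> na nb sub ab mD mf f0.
suff -> : D = \bigcup_n `[a n, b n]%classic.
  apply: ge0_nondecreasing_set_cvg_integral => //.
  - move=> n m nm; rewrite subsetEset; apply: subset_itv; rewrite bnd_simp.
      exact: na.
    exact: nb.
  - by move=> n; apply: measurable_funS mf.
  - by move=> n x /sub/f0.
apply/seteqP; split => x /=; last by case=> n _ /sub.
by move=> /ab[n xn]; exists n => //=; rewrite in_itv.
Qed.

Lemma exhaust_pos x : 0 < x -> exists n, n.+1%:R^-1 <= x <= n.+1%:R.
Proof.
(* A single integer has to dominate both [x] and [x^-1], hence the sum. *)
move=> x0; exists (Num.truncn (x + x^-1)).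
have xV0 : 0 < x^-1 by rewrite invr_gt0.
have := truncnS_gt (x + x^-1) => H.
rewrite -[X in _ <= X <= _]invrK lef_pV2 ?posrE// invrK.
apply/andP; split; lra.
Qed.

Lemma nonincreasing_invS : nonincreasing_seq (fun n => n.+1%:R^-1 : R).
Proof. by move=> n m nm; rewrite lef_pV2 ?posrE// ler_nat. Qed.

Lemma nondecreasing_natS : nondecreasing_seq (fun n => n.+1%:R : R).
Proof. by move=> n m nm; rewrite ler_nat. Qed.

Lemma integral_powR_segment p a b : p + 1 != 0 -> 0 < a -> a <= b ->
  (\int[mu]_(x in `[a, b]) (x `^ p)%:E =
   ((p + 1)^-1 * (b `^ (p + 1) - a `^ (p + 1)))%:E)%E.
Proof.
(* The fundamental theorem of calculus is applied with [a < b], so the degenerate segment is treated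
   apart. *)
move=> p1 a0; rewrite le_eqVlt => /predU1P[<-|ab].
  by rewrite set_itv1 integral_set1 subrr mulr0.
pose F x := (p + 1)^-1 * x `^ (p + 1).
have dF x : 0 < x -> is_derive x 1 F (x `^ p).
  move=> x0; have := is_derive1_powR (p + 1) x0 => d.
  apply: is_derive_eq.
  by rewrite addrK scalerA mulVf// scale1r.
have cF x : 0 < x -> {for x, continuous F}.
  by move=> x0; apply/differentiable_continuous/derivable1_diffP; case: (dF x x0).
rewrite (@continuous_FTC2 _ _ F)//.
- by rewrite -EFinB mulrBr.
- apply: continuous_within_pos => [x|x/=]; first exact: continuous_powR.
  by rewrite !in_itv/= andbT => /andP[+ _]; exact: lt_le_trans.
- split.
  + by move=> x; rewrite in_itv/= => /andP[ax _]; case: (dF x (lt_trans a0 ax)).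
  + exact/cvg_at_right_filter/cF.
  + exact/cvg_at_left_filter/cF/(lt_trans a0).
- move=> x; rewrite in_itv/= => /andP[ax _].
  by rewrite derive1E; case: (dF x (lt_trans a0 ax)).
Qed.

Lemma integrable_cover (D : set R) f (a b : R^nat) (M : R) :
  nonincreasing_seq a -> nondecreasing_seq b ->
  (forall n, `[a n, b n] `<=` D) ->
  (forall x, D x -> exists n, a n <= x <= b n) ->
  measurable D -> measurable_fun D f -> (forall x, D x -> 0 <= f x) ->
  (forall n, \int[mu]_(x in `[a n, b n]) (f x)%:E <= M%:E)%E ->
  mu.-integrable D (EFin \o f).
Proof.
move=> na nb sub ab mD mf f0 fM; apply/integrableP; split.
  exact/measurable_EFinP.
apply: (@le_lt_trans _ _ M%:E); last by rewrite ltry.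
have -> : (\int[mu]_(x in D) `|(EFin \o f) x| =
          \int[mu]_(x in D) (f x)%:E)%E.
  by apply: eq_integral => x; rewrite inE => /f0 fx /=; rewrite ger0_norm.
apply: (@cvge_le _ \oo _ _ (fun n => \int[mu]_(x in `[a n, b n]) (f x)%:E)%E).
  exact: nearW.
by apply: cvg_integral_cover => //; exact/measurable_EFinP.
Qed.

Lemma integrable_powR_at0 p : -1 < p ->
  mu.-integrable `]0%R, 1%R] (EFin \o (@powR R ^~ p)).
Proof.
move=> p1.
(* The bound [(p + 1)^-1] is the exact value of the integral over ]0, 1]. *)
apply: (@integrable_cover _ _ (fun n => n.+1%:R^-1) (fun=> 1) (p + 1)^-1) => //.
- exact: nonincreasing_invS.
- by move=> n x/=; rewrite !in_itv/= => /andP[+ ->]; rewrite andbT; exact: lt_le_trans.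
- move=> x/=; rewrite in_itv/= => /andP[x0 x1].
  by have [n /andP[xn _]] := exhaust_pos x0; exists n; rewrite xn.
- by apply: measurable_funS (measurable_powR p).
- by move=> x _; exact: powR_ge0.
move=> n; have p10 : 0 < p + 1 by lra.
rewrite integral_powR_segment ?gt_eqF ?invf_le1 ?ler1n// lee_fin powR1.
by rewrite ler_piMr ?invr_ge0 ?(ltW p10)// gerBl powR_ge0.
Qed.

Lemma integrable_powR_aty p : p < -1 ->
  mu.-integrable `[1%R, +oo[ (EFin \o (@powR R ^~ p)).
Proof.
move=> p1.
(* Again the bound is the exact value of the integral, positive because [p + 1 < 0]. *)
apply: (@integrable_cover _ _ (fun=> 1) (fun n => n.+1%:R) (- (p + 1)^-1)) => //.
- exact: nondecreasing_natS.
- by move=> n x/=; rewrite !in_itv/= => /andP[->].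
- move=> x/=; rewrite in_itv/= andbT => x1.
  by have [n /andP[_ xn]] := exhaust_pos (lt_le_trans ltr01 x1); exists n; rewrite x1.
- by apply: measurable_funS (measurable_powR p).
- by move=> x _; exact: powR_ge0.
move=> n; have p10 : p + 1 < 0 by lra.
rewrite integral_powR_segment ?lt_eqF ?ler1n// lee_fin powR1.
rewrite mulrBr mulr1 gerDr mulr_le0_ge0 ?powR_ge0// invr_le0; exact: ltW.
Qed.

(** Substitution along a decreasing map holds on segments; the segments [1/(n+1), n+1] and their
    images both exhaust the half-line, so both sides are limits of the same sequence. Non-negativity
    of [f] replaces integrability. *)
Lemma integral_powR_substitution t f : 0 < t ->
  (forall x, 0 < x -> {for x, continuous f}) -> (forall x, 0 < x -> 0 <= f x) ->
  (\int[mu]_(x in `]0%R, +oo[) (f x)%:E =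
   \int[mu]_(x in `]0%R, +oo[) (f (x `^ (- t)) * (t * x `^ (- t - 1)))%:E)%E.
Proof.
move=> t0 cf f0.
have tN0 : - t < 0 by rewrite oppr_lt0.
pose F x : R := x `^ (- t).
have dF x : 0 < x -> is_derive x 1 F (- t * x `^ (- t - 1)).
  exact: is_derive1_powR.
have F'E x : 0 < x -> F^`()%classic x = - t * x `^ (- t - 1).
  by move=> x0; rewrite derive1E; case: (dF x x0).
have cF x : 0 < x -> {for x, continuous F} by exact: continuous_powR.
have cF' x : 0 < x -> {for x, continuous F^`()%classic}.
  move=> x0.
  apply: (@cvg_trans _ ((- t * y `^ (- t - 1)) @[y --> x])).
    apply: (@near_eq_cvg _ _ (nbhs x)); near=> y; apply/esym/F'E; near: y.
    exact: lt_nbhsr.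
  rewrite F'E//.
  suff : {for x, continuous (fun y => - t * y `^ (- t - 1))} by [].
  by apply: cvgM; [exact: cvg_cst|exact: continuous_powR].
pose a n : R := n.+1%:R^-1; pose b n : R := n.+1%:R.
have a0 n : 0 < a n by rewrite /a.
have b0 n : 0 < b n by rewrite /b.
have ab n : a n <= b n.
  by rewrite (@le_trans _ _ 1)// ?invf_le1 ?ler1n.
have key n : (\int[mu]_(x in `[F (b n), F (a n)]) (f x)%:E =
   \int[mu]_(x in `[a n, b n]) (f (x `^ (- t)) * (t * x `^ (- t - 1)))%:E)%E.
  rewrite (@integration_by_substitution_decreasing _ F)//.
  - apply: eq_integral => x; rewrite inE/= in_itv/= => /andP[ax _].
    have -> : ((f \o F) * - F^`()%classic) x = f (F x) * - (F^`()%classic x) by [].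
    by rewrite F'E ?mulNr ?opprK//; exact: lt_le_trans ax.
  - move=> x y; rewrite !in_itv/= => _ /andP[ay _] xy.
    by apply: powR_Nltr => //; exact: lt_le_trans ay.
  - move=> x; rewrite in_itv/= => /andP[ax _].
    by apply: cF'; exact: lt_trans ax.
  - by apply/cvg_ex; exists (F^`()%classic (a n)); exact/cvg_at_right_filter/cF'.
  - by apply/cvg_ex; exists (F^`()%classic (b n)); exact/cvg_at_left_filter/cF'.
  - split.
    + by move=> x; rewrite in_itv/= => /andP[ax _]; case: (dF x (lt_trans (a0 n) ax)).
    + exact/cvg_at_right_filter/cF.
    + exact/cvg_at_left_filter/cF.
  - apply: continuous_within_pos => // x/=.
    rewrite !in_itv/= andbT => /andP[+ _]; apply: lt_le_trans.
    exact: powR_gt0.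
have R1 : (\int[mu]_(x in `[F (b n), F (a n)]) (f x)%:E)%E @[n --> \oo] -->
    (\int[mu]_(x in `]0%R, +oo[) (f x)%:E)%E.
  apply: cvg_integral_cover => //.
  - move=> n m nm; apply: powR_Nler => //; first exact: ltW.
    exact: nondecreasing_natS.
  - move=> n m nm; apply: powR_Nler => //; first exact: ltW.
    exact: nonincreasing_invS.
  - move=> n x/=; rewrite !in_itv/= andbT => /andP[+ _]; apply: lt_le_trans.
    exact: powR_gt0.
  - move=> x/=; rewrite in_itv/= andbT => x0.
    (* The preimage of [x] under [F] is trapped between [a n] and [b n]; applying the decreasing [F]
       traps [x] itself. *)
    have [n /andP[an nb]] := exhaust_pos (powR_gt0 (- t^-1) x0); exists n.
    have -> : x = F (x `^ (- t^-1)).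
      by rewrite /F -powRrM mulrNN mulVf ?gt_eqF// powRr1// ltW.
    by rewrite !powR_Nler// ?powR_gt0// ltW.
  - by apply/measurable_EFinP; exact: continuous_measurable_pos.
  - by move=> x/=; rewrite in_itv/= andbT lee_fin => /f0.
rewrite -(cvg_lim _ R1)//; under eq_fun do rewrite key.
apply/cvg_lim => //.
apply: cvg_integral_cover => //.
- exact: nonincreasing_invS.
- exact: nondecreasing_natS.
- by move=> n x/=; rewrite !in_itv/= andbT => /andP[+ _]; exact: lt_le_trans.
- by move=> x/=; rewrite in_itv/= andbT => /exhaust_pos.
- apply/measurable_EFinP; apply: continuous_measurable_pos => x x0.
  apply: cvgM; first by apply: continuous_comp; [exact: cF|exact/cf/powR_gt0].
  by apply: cvgM; [exact: cvg_cst|exact: continuous_powR].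
- move=> x/=; rewrite in_itv/= andbT lee_fin => x0.
  by rewrite mulr_ge0 ?f0 ?powR_gt0// mulr_ge0 ?powR_ge0// ltW.
Unshelve. all: by end_near. Qed.

End positive_half_line.

(** * Riemann sums as integrals of step functions *)

Section riemann_sums.
Context {R : realType}.
Implicit Types (f : R -> R) (x h M : R).
Local Notation mu := (@lebesgue_measure R).

(** For [h > 0], the right endpoint of the mesh cell containing [x]; cells are open on the left and
    closed on the right. *)
Definition ceil_step h x : R := h * (Num.ceil (x / h))%:~R.

Lemma ceil_step_itv h x : 0 < h -> x <= ceil_step h x < x + h.
Proof.
move=> h0; have := ceil_itv (x / h).
rewrite /ceil_step ltr_pdivlMr// ler_pdivrMr// intrB => /andP[c1 c2].
by apply/andP; split; lra.
Qed.

Lemma ceil_step_gt0 h x : 0 < h -> 0 < x -> 0 < ceil_step h x.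
Proof. by move=> h0 x0; have /andP[+ _] := ceil_step_itv x h0; exact: lt_le_trans. Qed.

Lemma ceil_step_cell h x n : 0 < h -> n%:R * h < x <= n.+1%:R * h ->
  ceil_step h x = n.+1%:R * h.
Proof.
move=> h0 /andP[nx xn]; rewrite /ceil_step (@ceil_def _ _ n.+1%:Z).
  by rewrite -pmulrn mulrC.
rewrite intrB -pmulrn -(natrB _ (ltn0Sn n)) subn1.
by rewrite ler_pdivrMr// ltr_pdivlMr// xn nx.
Qed.

Lemma measurable_ceil_step h : 0 < h -> measurable_fun [set: R] (ceil_step h).
Proof.
move=> h0; apply: nondecreasing_measurable => // x y xy.
rewrite ler_pM2l// ler_int; apply: le_ceil.
by rewrite ler_pM2r// invr_gt0.
Qed.

Lemma pos_cells h : 0 < h ->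
  (`]0%R, +oo[ = \bigcup_n `]n%:R * h, n.+1%:R * h] :> set R)%classic.
Proof.
move=> h0; apply/seteqP; split => x /=; rewrite in_itv/= andbT; last first.
  case=> n _/=; rewrite in_itv/= => /andP[+ _]; apply: le_lt_trans.
  by rewrite mulr_ge0// ltW.
move=> x0; have c0 : (0 < Num.ceil (x / h))%R by rewrite ceil_gt0 divr_gt0.
have /andP[] := ceil_itv (x / h); move: c0.
(* A positive ceiling has the form [n.+1], and this [n] is the index of the cell. *)
case: (Num.ceil (x / h)) => [[|n]|n]// _.
rewrite intrB -[1%:~R]/(1%:R) -pmulrn -natrB// subn1 => nx xn.
by exists n => //=; rewrite in_itv/= -ltr_pdivlMr// nx -ler_pdivrMr.
Qed.

Lemma trivIset_cells h : 0 < h ->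
  trivIset [set: nat] (fun n => `]n%:R * h, n.+1%:R * h]%classic : set R).
Proof.
move=> h0; apply/trivIsetP => i j _ _ ij; apply/seteqP; split => // x /=.
rewrite !in_itv/= => -[/andP[ix xi] /andP[jx xj]]; move: ij; apply/negP.
have ij : (i < j.+1)%N by rewrite -(ltr_nat R) -(ltr_pM2r h0) (lt_le_trans ix).
have ji : (j < i.+1)%N by rewrite -(ltr_nat R) -(ltr_pM2r h0) (lt_le_trans jx).
by rewrite negbK eqn_leq -ltnS ij.
Qed.

(** On each cell, of length [h], the composite is constant, and the cells partition the half-line.
    The equality lives in the extended reals, so no convergence is presupposed. *)
Lemma integral_ceil_step f h : 0 < h ->
  measurable_fun `](0:R), +oo[ f -> (forall x, 0 < x -> 0 <= f x) ->
  (\int[mu]_(x in `]0%R, +oo[) (f (ceil_step h x))%:E =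
   \sum_(0 <= n <oo) (h * f (n.+1%:R * h))%:E)%E.
Proof.
move=> h0 mf f0; rewrite (pos_cells h0) ge0_integral_bigcup//.
- apply: eq_eseriesr => n _.
  rewrite (eq_integral (cst (f (n.+1%:R * h))%:E)); last first.
    by move=> x; rewrite inE/= in_itv/= => /(ceil_step_cell h0) ->.
  rewrite integral_cst//= lebesgue_measure_itv/= lte_fin ltr_pM2r// ltr_nat ltnSn.
  by rewrite -EFinB -EFinM -mulrBl -natrB// subSnn mul1r mulrC.
- rewrite -(pos_cells h0); apply/measurable_EFinP.
  apply: measurable_comp mf _ => //.
    move=> _ [x /= + <-]; rewrite !in_itv/= !andbT; exact: ceil_step_gt0.
  exact: measurable_funS (measurable_ceil_step h0).
- rewrite -(pos_cells h0) => x/=; rewrite in_itv/= andbT => x0.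
  by rewrite lee_fin f0// ceil_step_gt0.
- exact: trivIset_cells.
Qed.

(** Dominated convergence: [ceil_step (h n) x] is squeezed between [x] and [x + h n], and [f] is
    continuous at [x]. *)
Lemma cvg_integral_ceil_step f (G : R -> R) M (h : R^nat) : 0 < M ->
  (forall x, 0 < x -> {for x, continuous f}) ->
  mu.-integrable `]0%R, +oo[ (EFin \o G) ->
  (forall k x : R, 0 < k <= M -> 0 < x -> `|f (ceil_step k x)| <= G x) ->
  (forall n, 0 < h n) -> h n @[n --> \oo] --> 0 ->
  (\int[mu]_(x in `]0%R, +oo[) (f (ceil_step (h n) x))%:E)%E @[n --> \oo] -->
  (\int[mu]_(x in `]0%R, +oo[) (f x)%:E)%E.
Proof.
move=> M0 cf iG fG h0 hcvg.
have mf := continuous_measurable_pos cf.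
(* The domination covers only steps at most [M], so the first [N] terms are dropped. *)
have [N _ hN] : \forall n \near \oo, h n <= M.
  by apply: (cvgr_le 0).
rewrite -(cvg_shiftn N).
apply: (@dominated_cvg _ _ _ mu _ _ (fun n x => (f (ceil_step (h (n + N)%N) x))%:E)
  (EFin \o f) (EFin \o G)) => //.
- move=> n; apply/measurable_EFinP; apply: measurable_comp mf _ => //.
    move=> _ [x /= + <-]; rewrite !in_itv/= !andbT; exact: ceil_step_gt0.
  exact: measurable_funS (measurable_ceil_step (h0 _)).
- move=> x/=; rewrite in_itv/= andbT => x0.
  apply: cvg_EFin; first exact: nearW.
  apply: (continuous_cvg _ (cf x x0)).
  apply: (@squeeze_cvgr _ _ _ _ (fun=> x) (fun n => x + h (n + N)%N)).
  + by apply: nearW => n; have /andP[-> /ltW] := ceil_step_itv x (h0 (n + N)%N).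
  + exact: cvg_cst.
  + rewrite -[X in _ --> X]addr0; apply: cvgD; first exact: cvg_cst.
    by rewrite (cvg_shiftn N).
- move=> n x/=; rewrite in_itv/= andbT => x0; rewrite lee_fin fG// h0/=.
  by apply: hN => /=; exact: leq_addl.
Qed.
End riemann_sums.

(** * The limiting integrand *)

Section limit_profile.
Context {R : realType}.
Implicit Types (f : R -> R) (s t x h r M : R).
Local Notation mu := (@lebesgue_measure R).

Lemma integral_pos_gt0 f x : 0 < x ->
  (forall y, 0 < y -> {for y, continuous f}) -> (forall y, 0 < y -> 0 <= f y) ->
  0 < f x -> (0 < \int[mu]_(y in `]0%R, +oo[) (f y)%:E)%E.
Proof.
move=> x0 cf f0 fx.
have fx2 : f x / 2 < f x by lra.
have : \forall y \near x, f x / 2 < f y by exact: (cvgr_gt (f x) (cf x x0)).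
move=> /nbhs_ballP[e /= e0 he].
have mfP := continuous_measurable_pos cf.
(* A segment to the right of [x] stays among the positive reals, and half the radius keeps it inside
   the open ball where [f] exceeds [f x / 2]. *)
have sub : `[x, x + e / 2] `<=` `]0, +oo[.
  move=> y/=; rewrite !in_itv/= andbT => /andP[+ _]; exact: lt_le_trans.
apply: (@lt_le_trans _ _ (\int[mu]_(y in `[x, (x + e / 2)%R]) (f x / 2)%:E)%E).
  rewrite integral_cst//= lebesgue_measure_itv/= lte_fin ifT; last by lra.
  by rewrite -EFinB -EFinM lte_fin mulr_gt0//; lra.
apply: (@le_trans _ _ (\int[mu]_(y in `[x, (x + e / 2)%R]) (f y)%:E)%E).
  apply: ge0_le_integral => //.
  - by move=> y _; rewrite lee_fin; lra.
  - by apply/measurable_EFinP; apply: measurable_funS mfP.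
  - move=> y /=; rewrite in_itv/= => /andP[xy ye]; rewrite lee_fin ltW//.
    by apply: he; rewrite /ball/= ler0_norm; lra.
apply: ge0_subset_integral => //; first exact/measurable_EFinP.
by move=> y /=; rewrite in_itv/= andbT lee_fin => /f0.
Qed.

(** * The profile function and its domination *)

Definition profile s t x : R := x `^ (- s + 2 * t) * sin (x `^ (- t)) ^+ 2.

Lemma profile_ge0 s t x : 0 <= profile s t x.
Proof. by rewrite mulr_ge0 ?powR_ge0// sqr_ge0. Qed.

Lemma continuous_profile s t x : 0 < x -> {for x, continuous (profile s t)}.
Proof.
move=> x0; apply: cvgM; first exact: continuous_powR.
rewrite /= expr2; under eq_fun do rewrite expr2.
have c : {for x, continuous (fun y => sin (y `^ (- t)))}.
  apply: continuous_comp; first exact: continuous_powR.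
  exact: continuous_sin.
exact: cvgM.
Qed.

Lemma sqr_sin_le x : sin x ^+ 2 <= x ^+ 2.
Proof.
rewrite -real_normK ?num_real// -(real_normK (num_real x)).
by rewrite lerXn2r ?nnegrE// norm_sin_le.
Qed.

Lemma sqr_sin_le1 x : sin x ^+ 2 <= 1.
Proof. by rewrite sin2cos2 gerBl sqr_ge0. Qed.

(* Valid for every step at most [M]: a point of ]0, 1] is rounded up to at most
   [1 + M], which is needed when the exponent [- s + 2 * t] is positive. *)
Definition majorant s t M x : R :=
  ((fun y => y `^ (- s + 2 * t) + (1 + M) `^ (- s + 2 * t)) \_ `]0, 1]) x +
  ((@powR R ^~ (- s)) \_ `[1, +oo[) x.

(** Near 0 the exponent [- s + 2 * t] exceeds -1 by the second hypothesis, and the added constant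
    lives on a bounded interval; at infinity [- s < -1]. *)
Lemma integrable_majorant s t M : 1 < s -> s - 2 * t < 1 ->
  mu.-integrable `]0%R, +oo[ (EFin \o majorant s t M).
Proof.
move=> s1 st.
rewrite (_ : EFin \o _ = (EFin \o ((fun y => y `^ (- s + 2 * t) +
    (1 + M) `^ (- s + 2 * t)) \_ `]0, 1])) \+ (EFin \o ((@powR R ^~ (- s)) \_ `[1, +oo[))); last by [].
apply: integrableD => //; rewrite -restrict_EFin; apply/integrable_restrict => //.
  rewrite (_ : _ `&` _ = `]0, 1]%classic); last first.
    apply/seteqP; split=> x /=; rewrite !in_itv/= ?andbT; first by case.
    by move=> /andP[-> ->].
  rewrite (_ : EFin \o _ = (EFin \o (@powR R ^~ (- s + 2 * t))) \+
    (EFin \o cst ((1 + M) `^ (- s + 2 * t)))); last by [].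
  apply: integrableD => //; first by apply: integrable_powR_at0; lra.
  apply: measurable_bounded_integrable => //.
    by rewrite /= lebesgue_measure_itv/= lte01 -EFinB ltry.
  exact: bounded_cst.
rewrite (_ : _ `&` _ = `[1%R, +oo[%classic); last first.
  apply/seteqP; split=> x /=; rewrite !in_itv/= ?andbT; first by case.
  by move=> x1; split => //; exact: lt_le_trans x1.
by apply: integrable_powR_aty; lra.
Qed.

(** For [x <= 1] the squared sine is bounded by 1; beyond 1 it is bounded by the square of its
    argument, which lowers the exponent to [- s]. *)
Lemma profile_le_majorant s t M x y : 0 < t -> 1 < s -> 0 <= M -> 0 < x ->
  x <= y <= x + M -> `|profile s t y| <= majorant s t M x.
Proof.
move=> t0 s1 M0 x0 /andP[xy yx]; rewrite ger0_norm ?profile_ge0//.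
have y0 : 0 < y by exact: lt_le_trans xy.
rewrite /majorant !patchE !mem_setE !in_itv/= x0/= andbT.
have [x1|x1] := leP x 1.
  (* Both pieces of the majorant are active at [x = 1]; the second is discarded by
     non-negativity. *)
  apply: (@le_trans _ _ (x `^ (- s + 2 * t) + (1 + M) `^ (- s + 2 * t))); last first.
    by rewrite lerDl; case: ifP => // _; exact: powR_ge0.
  apply: (@le_trans _ _ (y `^ (- s + 2 * t))).
    by rewrite ler_piMr ?powR_ge0// sqr_sin_le1.
  have [a0|a0] := leP (- s + 2 * t) 0.
    by rewrite (le_trans (powR_Nler a0 x0 xy))// lerDl powR_ge0.
  rewrite (@le_trans _ _ ((1 + M) `^ (- s + 2 * t)))// ?lerDr ?powR_ge0//.
  apply: ge0_ler_powR; rewrite ?nnegrE ?(ltW a0)//; lra.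
rewrite (ltW x1) add0r.
apply: (@le_trans _ _ (y `^ (- s))); last by apply: powR_Nler => //; lra.
apply: (@le_trans _ _ (y `^ (- s + 2 * t) * (y `^ (- t)) ^+ 2)).
  by rewrite ler_wpM2l ?powR_ge0// sqr_sin_le.
rewrite -powR_mulrn ?powR_ge0// -powRrM -powRD ?(gt_eqF y0) ?implybT//.
have -> // : - s + 2 * t + - t * 2%:R = - s by ring.
Qed.

Lemma profile_ceil_step_le s t M h x : 0 < t -> 1 < s -> 0 < h <= M -> 0 < x ->
  `|profile s t (ceil_step h x)| <= majorant s t M x.
Proof.
move=> t0 s1 /andP[h0 hM] x0; apply: profile_le_majorant => //.
  by apply: le_trans hM; exact: ltW.
have /andP[-> /ltW yx] := ceil_step_itv x h0.
by rewrite (le_trans yx)// lerD2l.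
Qed.

(** Taking [M := h] in the majorant admits every positive step, whence convergence of the series for
    all [r > 0] and not only for large [r]. *)
Lemma integrable_profile_ceil_step s t h : 0 < t -> 1 < s -> s - 2 * t < 1 -> 0 < h ->
  mu.-integrable `]0%R, +oo[ (EFin \o (profile s t \o ceil_step h)).
Proof.
move=> t0 s1 st h0.
have mf := continuous_measurable_pos (@continuous_profile s t).
apply: le_integrable (integrable_majorant h s1 st) => //.
  apply/measurable_EFinP; apply: measurable_comp mf _ => //.
    move=> _ [x /= + <-]; rewrite !in_itv/= !andbT; exact: ceil_step_gt0.
  exact: measurable_funS (measurable_ceil_step h0).
move=> x /=; rewrite in_itv/= andbT => x0.
rewrite lee_fin (le_trans _ (ler_norm _))// profile_ceil_step_le// h0 lexx//.
Qed.

(** * The series as a Riemann sum *)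

(** [fine] would send an infinite integral to 0; [integrable_profile_ceil_step] rules this out for
    the parameters considered. *)
Definition step_integral s t h : R :=
  fine (\int[mu]_(x in `]0%R, +oo[) (profile s t (ceil_step h x))%:E)%E.

Lemma g_term_profile s t r n : 0 < t -> 0 < r ->
  g_term s t r n.+1 = r `^ ((- s + 2 * t + 1) / t) *
    (r `^ (- t^-1) * profile s t (n.+1%:R * r `^ (- t^-1))).
Proof.
move=> t0 r0; have tN0 : t != 0 by rewrite gt_eqF.
rewrite /g_term /profile !powRM ?powR_ge0// -!powRrM.
have -> : - t^-1 * - t = 1 by rewrite mulrNN mulVf.
rewrite powRr1 ?(ltW r0)//.
(* The sines already agree, since (n h)^(-t) = n^(-t) r for h = r^(-1/t). The remaining powers of
   [r] have exponents summing to 0. *)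
have E : r `^ ((- s + 2 * t + 1) / t) * r `^ (- t^-1) *
    r `^ (- t^-1 * (- s + 2 * t)) = 1.
  rewrite -!powRD ?(gt_eqF r0) ?implybT//.
  by rewrite (_ : _ + _ + _ = 0) ?powRr0//; field.
by rewrite -[LHS]mul1r -[X in X * _ = _]E; ring.
Qed.

Lemma cvg_g_series s t r : 0 < t -> 1 < s -> s - 2 * t < 1 -> 0 < r ->
  \sum_(1 <= n < N) g_term s t r n @[N --> \oo] -->
  r `^ ((- s + 2 * t + 1) / t) * step_integral s t (r `^ (- t^-1)).
Proof.
move=> t0 s1 st r0; set h := r `^ (- t^-1); have h0 : 0 < h by exact: powR_gt0.
(* Shifting aligns the series, indexed from 1, with the cells, indexed from 0. *)
rewrite -(cvg_shiftS (fun N => \sum_(1 <= n < N) g_term s t r n)).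
rewrite (_ : (fun N => _) = fun N : nat => r `^ ((- s + 2 * t + 1) / t) *
    \sum_(0 <= n < N) (h * profile s t (n.+1%:R * h))); last first.
  apply/funext => N; rewrite big_add1/= big_distrr/=.
  by apply: eq_bigr => n _; exact: g_term_profile.
apply: cvgM; first exact: cvg_cst.
have intE := integral_ceil_step h0 (continuous_measurable_pos
  (@continuous_profile s t)) (fun x _ => profile_ge0 s t x).
have fin : (\int[mu]_(x in `]0%R, +oo[) (profile s t (ceil_step h x))%:E)%E
  \is a fin_num.
  apply: integrable_fin_num => //.
  exact: (integrable_profile_ceil_step t0 s1 st h0).
(* Series of non-negative terms converge in the extended reals; finiteness of the limit then brings
   the convergence back to [R]. *)
have H : ((\sum_(0 <= n < N) h * profile s t (n.+1%:R * h))%:E)%E @[N --> \oo]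
    --> (step_integral s t h)%:E.
  rewrite /step_integral fineK// intE.
  under eq_fun do rewrite -sumEFin.
  apply: is_cvg_nneseries => n _ _.
  by rewrite lee_fin mulr_ge0 ?profile_ge0// ltW.
exact: (fine_cvg H).
Qed.

(** * Identification of the constant *)

Lemma C_integrand_substitution s t x : 0 < t -> 0 < x ->
  C_integrand s t (x `^ (- t)) * (t * x `^ (- t - 1)) = t * profile s t x.
Proof.
move=> t0 x0; have tN0 : t != 0 by rewrite gt_eqF.
rewrite /C_integrand /profile -powRrM.
(* The second factor comes from the Jacobian, and the exponents add up: -(s - 3t - 1) - t - 1 = -s +
   2t. *)
have <- : x `^ (- t * ((s - 3 * t - 1) / t)) * x `^ (- t - 1) =
    x `^ (- s + 2 * t).
  by rewrite -powRD ?(gt_eqF x0) ?implybT//; congr (_ `^ _); field.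
ring.
Qed.

Lemma continuous_C_integrand s t x : 0 < x -> {for x, continuous (C_integrand s t)}.
Proof.
move=> x0; apply: cvgM; first exact: continuous_powR.
rewrite /= expr2; under eq_fun do rewrite expr2.
by apply: cvgM; exact: continuous_sin.
Qed.

Lemma C_integrand_ge0 s t x : 0 <= C_integrand s t x.
Proof. by rewrite mulr_ge0 ?powR_ge0// sqr_ge0. Qed.

Lemma integral_C_integrand s t : 0 < t ->
  (\int[mu]_(x in `]0%R, +oo[) (C_integrand s t x)%:E =
   t%:E * \int[mu]_(x in `]0%R, +oo[) (profile s t x)%:E)%E.
Proof.
move=> t0; rewrite (integral_powR_substitution t0).
- rewrite -ge0_integralZl_EFin//.
  + apply: eq_integral => x; rewrite inE/= in_itv/= andbT => x0.
    by rewrite C_integrand_substitution.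
  + by move=> x _; rewrite lee_fin profile_ge0.
  + by apply/measurable_EFinP; exact: (continuous_measurable_pos (@continuous_profile s t)).
  + exact: ltW.
- exact: continuous_C_integrand.
- by move=> x _; exact: C_integrand_ge0.
Qed.

(** * Passage to the limit as the mesh tends to 0 *)

Lemma cvg_step_integral s t (h : R^nat) : 0 < t -> 1 < s -> s - 2 * t < 1 ->
  (forall n, 0 < h n) -> h n @[n --> \oo] --> 0 ->
  (\int[mu]_(x in `]0%R, +oo[) (profile s t (ceil_step (h n) x))%:E)%E
    @[n --> \oo] --> (\int[mu]_(x in `]0%R, +oo[) (profile s t x)%:E)%E.
Proof.
move=> t0 s1 st h0 hc; apply: (@cvg_integral_ceil_step _ _ (majorant s t 1) 1) => //.
- exact: continuous_profile.
- exact: integrable_majorant.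
- by move=> k x k1 x0; exact: profile_ceil_step_le.
Qed.

(** The majorant with [M := 0] is the case without rounding, [y = x]. *)
Lemma integrable_profile s t : 0 < t -> 1 < s -> s - 2 * t < 1 ->
  mu.-integrable `]0%R, +oo[ (EFin \o profile s t).
Proof.
move=> t0 s1 st; apply: le_integrable (integrable_majorant 0 s1 st) => //.
  by apply/measurable_EFinP; exact: (continuous_measurable_pos (@continuous_profile s t)).
move=> x /=; rewrite in_itv/= andbT => x0.
by rewrite lee_fin (le_trans _ (ler_norm _))// profile_le_majorant// addr0 lexx.
Qed.

Lemma cvg_powR_Ny p : p < 0 -> x `^ p @[x --> +oo] --> (0 : R).
Proof.
move=> p0; apply/cvgr0Pnorm_lt => e e0.
near=> x; rewrite ger0_norm ?powR_ge0//.
have -> : e = (e `^ p^-1) `^ p.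
  by rewrite -powRrM mulVf ?lt_eqF// powRr1// ltW.
by apply: powR_Nltr; rewrite ?powR_gt0//; near: x; exact: nbhs_pinfty_gt.
Unshelve. all: by end_near. Qed.

Lemma integral_profile_gt0 s t :
  (0 < \int[mu]_(x in `]0%R, +oo[) (profile s t x)%:E)%E.
Proof.
apply: (integral_pos_gt0 ltr01 (@continuous_profile s t)).
  by move=> x _; exact: profile_ge0.
rewrite /profile !powR1 mul1r exprn_gt0// sin2_gt0//; lra.
Qed.

Lemma cvg_step_integraly s t : 0 < t -> 1 < s -> s - 2 * t < 1 ->
  step_integral s t (r `^ (- t^-1)) @[r --> +oo] -->
  fine (\int[mu]_(x in `]0%R, +oo[) (profile s t x)%:E)%E.
Proof.
(* Dominated convergence is sequential, so the limit in [r] is tested along sequences; a tail on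
   which [u] is positive yields positive steps. *)
move=> t0 s1 st; apply/cvg_pinftyP => u uy.
have [N _ hN] : \forall n \near \oo, 0 < u n by move: uy => /cvgryPgt; apply.
rewrite -(cvg_shiftn N); apply: fine_cvg.
rewrite fineK; last exact/integrable_fin_num/integrable_profile.
apply: (@cvg_step_integral s t (fun n => u (n + N)%N `^ (- t^-1))) => //.
  by move=> n; apply/powR_gt0/hN => /=; exact: leq_addl.
rewrite (cvg_shiftn N (fun n => u n `^ (- t^-1))).
have tN0 : - t^-1 < 0 by rewrite oppr_lt0 invr_gt0.
exact: cvg_comp uy (cvg_powR_Ny tN0).
Qed.

End limit_profile.

Theorem proposition4p3 (R : realType) (s t : R)
    (ht : 0 < t) (hs : 1 < s) (hst : s - 2 * t < 1) :
  [/\ (* the series defining g converges for every r >= 0 *)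
      forall r : R, 0 <= r ->
        cvgn (fun N : nat => \sum_(1 <= n < N) g_term s t r n),
      (* the integral defining C_ converges *)
      (@lebesgue_measure R).-integrable `]0, +oo[
        (EFin \o C_integrand s t)
    & (* g r = C_ * r ^ ((- s + 2 t + 1) / t) * (1 + o(1)) as r --> +oo *)
      exists eps : R -> R,
        eps r @[r --> +oo] --> 0 /\
        \forall r \near +oo,
          g s t r = C_ s t * r `^ ((- s + 2 * t + 1) / t) * (1 + eps r)].
Proof.
set J := fine (\int[@lebesgue_measure R]_(x in `]0%R, +oo[) (profile s t x)%:E)%E.
have Jfin : (\int[@lebesgue_measure R]_(x in `]0%R, +oo[) (profile s t x)%:E)%E
    \is a fin_num.
  exact/integrable_fin_num/integrable_profile.
(* Positivity of the limit is what allows the relative error to be formed by dividing by [J]. *)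
have J0 : 0 < J.
  by rewrite fine_gt0// integral_profile_gt0 -ge0_fin_numE// ltW// integral_profile_gt0.
have CJ : C_ s t = J.
  rewrite /C_ /Rintegral integral_C_integrand// fineM//= mulrA mulVf ?mul1r//.
  by rewrite gt_eqF.
split.
(* The rescaling requires [r > 0]; at [r = 0] every term vanishes. *)
- move=> r; rewrite le_eqVlt => /predU1P[<-|r0].
    rewrite (_ : (fun N => _) = cst 0); first exact: is_cvg_cst.
    apply/funext => N; rewrite big1// => n _.
    by rewrite /g_term mulr0 sin0 expr0n mulr0.
  exact: cvgP (cvg_g_series ht hs hst r0).
- apply/integrableP; split.
    apply/measurable_EFinP.
    exact: (continuous_measurable_pos (@continuous_C_integrand _ s t)).
  rewrite (_ : integral _ _ _ =
    \int[@lebesgue_measure R]_(x in `]0%R, +oo[) (C_integrand s t x)%:E)%E.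
    by rewrite integral_C_integrand// -(fineK Jfin) -EFinM ltry.
  by apply: eq_integral => x _ /=; rewrite ger0_norm// C_integrand_ge0.
(* The choice makes [J * (1 + eps r)] equal to the Riemann sum, so the required identity is exact
   for every [r > 0]. *)
- exists (fun r => step_integral s t (r `^ (- t^-1)) / J - 1); split.
    rewrite -(subrr 1) -[X in X - 1](divff (lt0r_neq0 J0)).
    apply: cvgB; last exact: cvg_cst.
    by apply: cvgM; [exact: cvg_step_integraly|exact: cvg_cst].
  near=> r; have r0 : 0 < r by near: r; exact: nbhs_pinfty_gt.
  rewrite /g (cvg_lim _ (cvg_g_series ht hs hst r0))// CJ (addrC 1) subrK.
  by field; exact: lt0r_neq0.
Unshelve. all: by end_near. Qed.
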